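(* Let $k$ be a positive integer and let $G$ be a $k$-degenerate graph with maximum degree $\Delta(G)$. If $\Delta(G) \ge 2k^2-k$, then $\operatorname{la}(G) = \left\lceil \frac{\Delta(G)}{2}\right\rceil$.
   Context: All graphs are simple: finite, undirected, without loops or multiple edges. $\Delta(G)$ is the maximum degree of $G$. A linear forest is a union of vertex-disjoint paths (a path may be a single isolated vertex). The linear arboricity $\operatorname{la}(G)$ is the minimum number of linear forests needed to partition the edge set of $G$. For a positive integer $k$, a graph $G$ is $k$-degenerate if it can be reduced to a trivial graph by successive removal of vertices of degree at most $k$; equivalently, every (nonempty) subgraph of $G$ has a vertex of degree at most $k$ in that subgraph. *)

(* Defs.v *)
From mathcomp Require Import all_boot.
From mathcomp Require Import boolp.
Set Implicit Arguments.
Unset Strict Implicit.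
Unset Printing Implicit Defensive.

Record sgraph := SGraph {
  vertex :> finType;
  adj : rel vertex;
  adj_sym : symmetric adj;
  adj_irrefl : irreflexive adj }.

Definition degree_in (G : sgraph) (S : {set G}) (x : G) : nat :=
  #|[set y in S | adj x y]|.

Definition max_degree (G : sgraph) : nat := \max_(x : G) degree_in [set: G] x.

Definition edges (G : sgraph) : {set {set G}} :=
  [set [set x; y] | x in G, y in G & adj x y].

(* [reducible k S]: the subgraph induced on [S] can be reduced to a trivial
   graph by successively removing vertices whose current degree is at most [k].
   The bound [#|S| <= 1] also accepts the graph without vertices. *)
Inductive reducible (G : sgraph) (k : nat) : {set G} -> Prop :=
| reducible_trivial (S : {set G}) : #|S| <= 1 -> reducible k S
| reducible_remove (S : {set G}) (x : G) :
    x \in S -> degree_in S x <= k -> reducible k (S :\ x) -> reducible k S.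

Definition degenerate (k : nat) (G : sgraph) : Prop := reducible k [set: G].

Definition path_edges (T : finType) (p : seq T) : {set {set T}} :=
  [set [set u.1; u.2] | u in zip p (behead p)].

(* A linear forest is given by its edge set [F], as a spanning subgraph on [T]:
   the paths in [ps] are pairwise disjoint and without repeated vertices, and
   one-vertex paths account for the vertices that [F] leaves isolated. *)
Definition linear_forest (T : finType) (F : {set {set T}}) : Prop :=
  exists ps : seq (seq T),
    [/\ [::] \notin ps, perm_eq (flatten ps) (enum T) &
        F = \bigcup_(p <- ps) path_edges p].

Definition linear_forest_partition (G : sgraph) (n : nat) : Prop :=
  exists P : {set {set {set G}}},
    [/\ partition P (edges G), {in P, forall F, linear_forest F} & #|P| = n].

Lemma linear_forest1 (T : finType) (x y : T) :
  x != y -> linear_forest [set [set x; y]].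
Proof.
move=> xy; set s := [seq z <- enum T | z \notin [:: x; y]].
exists ([:: x; y] :: [seq [:: z] | z <- s]); split.
- by rewrite inE /=; apply/mapP => -[].
- have -> : flatten ([:: x; y] :: [seq [:: z] | z <- s]) = [:: x; y] ++ s.
    by congr (_ ++ _); elim: s => //= z s ->.
  apply: uniq_perm; rewrite ?enum_uniq //.
    rewrite cat_uniq filter_uniq ?enum_uniq //= inE xy /= andbT.
    by apply/hasPn => z; rewrite mem_filter => /andP[].
  move=> z; rewrite mem_cat mem_filter mem_enum andbT.
  exact: orbN.
- rewrite big_cons big_map big1 ?setU0 => [|z _]; last first.
    by apply/setP => E; rewrite inE; apply/imsetP => -[].
  apply/setP => E; rewrite inE; apply/eqP/imsetP => [->|[u]].
    by exists (x, y); rewrite ?inE.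
  by rewrite inE => /eqP ->.
Qed.

Lemma linear_forest_partition_exists (G : sgraph) :
  exists n, `[< linear_forest_partition G n >].
Proof.
pose P := [set [set E] | E in edges G].
exists #|P|; apply/asboolP; exists P; split=> //.
- apply/and3P; split.
  + rewrite /cover; apply/eqP/setP => E; apply/bigcupP/idP.
      by move=> [_ /imsetP[E' E'G ->]]; rewrite inE => /eqP ->.
    by move=> EG; exists [set E]; rewrite ?inE ?imset_f.
  + apply/trivIsetP => _ _ /imsetP[E _ ->] /imsetP[E' _ ->] EE'.
    by rewrite disjoints1 inE; apply: contraNneq EE' => ->.
  + apply/imsetP => -[E _ /setP/(_ E)].
    by rewrite !inE eqxx.
- move=> _ /imsetP[_ /imset2P[x y _ xy ->] ->].
  apply: linear_forest1; apply: contraTneq xy => ->.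
  by rewrite inE adj_irrefl.
Qed.

Definition linear_arboricity (G : sgraph) : nat :=
  ex_minn (linear_forest_partition_exists G).

(* Main.v *)
Require Import Defs.
From mathcomp Require Import all_boot.
From mathcomp Require Import perm boolp zify.
Set Implicit Arguments.
Unset Strict Implicit.
Unset Printing Implicit Defensive.

(** The lower bound is local: a linear forest has at most two edges at a vertex,
so n linear forests cover at most 2n edges at a vertex of maximum degree
([max_degree_le_linear_forests]).

For the upper bound, let t be half the maximum degree, rounded up.  Order the
vertices so that every vertex has at most k neighbours of lower rank, its
parents; the other neighbours are its children.  If the edges are coloured with
t colours so that each colour occurs at most twice at each vertex and the edges
from a vertex to its parents have pairwise distinct colours, then every colour
class is a linear forest: its maximum degree is at most 2, and it has no cycle,
because the vertex of highest rank on a cycle would have two parents in it.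

Such a colouring is encoded by a [labelling]: every dart (v, u), that is, edge vu
seen from its end v, gets the colour of the edge together with one of two slots
at v.  The darts at v must have distinct labels, and darts towards parents must
use the slot [false].  Equivalently, each vertex is split in two, one half
containing all the parent edges, and the split graph is properly edge-coloured.
The split is not fixed in advance: the slots may change when an edge is
recoloured.

A labelling is built by adding one edge at a time ([extend_labelling]).  The edge
xy is chosen with x of highest rank among the vertices that have children and y a
child of x.  Then no child of x has children, so each has degree at most k.
Remove xy and label the rest.  Some label (c, s) is unused at x, since x
has lost an edge and there are 2t labels; we may assume that c occurs at y.  Some
colour a does not occur at y, and we may assume that the label (a, true) occurs
at x; it does so on an edge to a child y', because of the slot, and we may assume
that c occurs at y'.  Recolouring xy' with c and xy with a would do if c were
absent from y'.  As a and c occur at y' and c occurs at y, the two vertices see at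
most 2k - 2 colours together, so t >= 2k - 1 leaves a colour b absent from both.
In the subgraph of colours b and c, with edges joined at a vertex when they have
the same slot there, all components are paths and cycles, and y, y' and the b-edge
of slot s at x (if there is none, colour xy with b) are three ends of paths.  A
path has two ends only, so exchanging b and c along the path from y or along the
path from y' frees c at y or at y' and keeps (c, s) unused at x.

The inequality t >= 2k - 1 follows from 4k - 3 <= 2k^2 - k. *)

(** * Two involutions of a finite set *)

Section TwoInvolutions.

Variables (D : finType) (al be : D -> D).
Hypotheses (alK : involutive al) (beK : involutive be).

Let step := be \o al.

Lemma step_inj : injective step.
Proof. by apply: inj_comp; apply: inv_inj. Qed.

(** The group generated by two involutions is dihedral: [be] conjugates the
rotation [step] into its inverse. *)
Lemma iter_step_reflection n z : iter n step (be (iter n step z)) = be z.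
Proof.
elim: n => // n IHn; rewrite iterSr [in X in be X]iterS -{}[RHS]IHn.
by congr iter; rewrite /step /= beK alK.
Qed.

Variable d : D.
Hypothesis be_d : be d = d.

(** When [be] fixes [d], reflecting the orbit of [d] under [step] maps it to itself,
so this orbit is already the orbit of [d] under both involutions. *)
Lemma fconnect_reflection z :
  fconnect step d z -> fconnect step d (be z) /\ fconnect step d (al z).
Proof.
have be_closed y : fconnect step d y -> fconnect step d (be y).
  move=> /iter_findex <-; set n := findex _ _ _.
  rewrite (fconnect_sym step_inj) -[X in fconnect _ _ X]be_d.
  by rewrite -(iter_step_reflection n d) fconnect_iter.
move=> dz; split; first exact: be_closed.
by rewrite -[al z]beK; apply/be_closed/(connect_trans dz)/fconnect1.
Qed.

(** A path has at most two ends.  On the cyclic orbit of [d], the map [be] is the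
reflection i |-> -i, whose fixpoints are 0 and possibly half of the length. *)
Lemma fixpoints_in_orbit d1 d2 :
  be d1 = d1 -> be d2 = d2 -> d1 != d -> d2 != d ->
  fconnect step d d1 -> fconnect step d d2 -> d1 = d2.
Proof.
have half z : be z = z -> z != d -> fconnect step d z ->
    (findex step d z).*2 = order step d.
  move=> bez zd dz; have := findex_max dz; have := iter_findex dz.
  set n := findex _ _ _; set m := order _ _ => zE ltnm.
  have per : iter n.*2 step d = d.
    by rewrite -addnn iterD zE -bez -zE iter_step_reflection.
  have n_gt0 : 0 < n by rewrite lt0n findex_eq0 eq_sym.
  have returns i : i < m -> iter i step d = d -> i = 0.
    by move=> lti di; rewrite -(findex_iter lti) di findex0.
  case: (ltnP n.*2 m) => [lt2n|le_m2n].
    by have := returns _ lt2n per; lia.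
  have := returns (n.*2 - m).
  by rewrite -{1}(iter_order step_inj d) -iterD subnK // per => /(_ _ erefl); lia.
move=> bed1 bed2 d1d d2d dd1 dd2.
rewrite -(iter_findex dd1) -(iter_findex dd2).
by congr (iter _ _ _); apply: double_inj; rewrite !half.
Qed.

End TwoInvolutions.

(** * Labellings of darts by a colour and a slot *)

Section Labellings.

Variables (T : finType) (r : T -> nat) (t : nat).
Implicit Types (e : rel T) (g : T -> T -> 'I_t * bool).

Definition labelling e g :=
  [/\ forall u v, (g u v).1 = (g v u).1,
      forall v u w, e v u -> e v w -> g v u = g v w -> u = w
    & forall v u, e v u -> r u < r v -> (g v u).2 = false].

Definition free e g v l := forall u, e v u -> g v u != l.

Definition is_pair (x y u v : T) :=
  (u == x) && (v == y) || (u == y) && (v == x).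

Definition del e x y : rel T := fun u v => e u v && ~~ is_pair x y u v.

Definition relabel g x y lx ly : T -> T -> 'I_t * bool :=
  fun u v => if (u == x) && (v == y) then lx
             else if (u == y) && (v == x) then ly else g u v.

Lemma labelling_sub e e' g :
  (forall u v, e' u v -> e u v) -> labelling e g -> labelling e' g.
Proof.
move=> sub [gsym ginj gpar]; split=> // [v u w /sub vu /sub vw|v u /sub vu].
  exact: ginj.
exact: gpar.
Qed.

Lemma relabel_labelling e g x y c s :
  r x < r y -> labelling (del e x y) g ->
  free (del e x y) g x (c, s) -> free (del e x y) g y (c, false) ->
  labelling e (relabel g x y (c, s) (c, false)).
Proof.
move=> rxy [gsym ginj gpar] fx fy.
have xy : x != y by apply: contraTneq rxy => ->; rewrite ltnn.
have yx : y != x by rewrite eq_sym.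
split.
- move=> u v; rewrite /relabel (andbC (v == x)) (andbC (v == y)).
  by case: ifP => [/andP[/eqP-> /eqP->]|_]; rewrite ?(negPf xy) //=; case: ifP.
- have old v u : e v u -> ~~ is_pair x y v u -> del e x y v u.
    by move=> vu nvu; apply/andP.
  have key v u w : e v u -> e v w -> is_pair x y v u -> ~~ is_pair x y v w ->
      relabel g x y (c, s) (c, false) v u <> g v w.
    move=> vu vw /orP[]/andP[/eqP vE /eqP uE] nvw; subst v u.
      rewrite /relabel !eqxx /= => E.
      by have := fx _ (old _ _ vw nvw); rewrite E eqxx.
    rewrite /relabel !eqxx (negPf yx) /= => E.
    by have := fy _ (old _ _ vw nvw); rewrite E eqxx.
  have relabelE v u : ~~ is_pair x y v u -> relabel g x y (c, s) (c, false) v u = g v u.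
    by rewrite negb_or /relabel => /andP[/negPf-> /negPf->].
  move=> v u w vu vw; case: (boolP (is_pair x y v u)) => pu;
    case: (boolP (is_pair x y v w)) => pw.
  + move=> _; move: pu pw => /orP[]/andP[/eqP-> /eqP->].
      by rewrite /is_pair eqxx (negPf xy) orbF => /eqP.
    by rewrite /is_pair eqxx (negPf yx) => /eqP.
  + by move=> E; case: (key _ _ _ vu vw pu pw); rewrite E relabelE.
  + by move=> E; case: (key _ _ _ vw vu pw pu); rewrite -E relabelE.
  + by rewrite !relabelE //; apply: ginj; apply: old.
- move=> v u vu ruv; rewrite /relabel; case: ifP => [/andP[/eqP vE /eqP uE]|n1].
    by subst; lia.
  by case: ifP => // n2; apply: gpar => //; rewrite /del vu /is_pair n1 n2.
Qed.

(** * Kempe chains *)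

Section Kempe.

Variables (e : rel T) (g : T -> T -> 'I_t * bool) (b c : 'I_t).
Hypothesis g_lab : labelling e g.

Definition exchange (l : 'I_t * bool) := (tperm b c l.1, l.2).

(** The chains are walked on darts: [opposite] goes to the other end of an edge, and
[partner] passes at a vertex to the edge of the exchanged colour with the same
slot.  It fixes the darts where a chain ends. *)
Definition partner (p : T * T) : T * T :=
  if [pick u | [&& e p.1 p.2, e p.1 u & g p.1 u == exchange (g p.1 p.2)]]
  is Some u then (p.1, u) else p.

Definition opposite (p : T * T) : T * T := (p.2, p.1).

Lemma exchangeK : involutive exchange.
Proof. by case=> a s; rewrite /exchange /= tpermK. Qed.

Lemma oppositeK : involutive opposite.
Proof. by case. Qed.

Lemma partnerE v u w :
  e v u -> e v w -> g v w = exchange (g v u) -> partner (v, u) = (v, w).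
Proof.
move=> vu vw gw; rewrite /partner /=.
case: pickP => [w' /and3P[_ vw' /eqP gw']|/(_ w)].
  by case: g_lab => _ ginj _; rewrite (ginj v w' w) // gw gw'.
by rewrite vu vw gw eqxx.
Qed.

Lemma partner_fix v u : free e g v (exchange (g v u)) -> partner (v, u) = (v, u).
Proof.
move=> fr; rewrite /partner /=; case: pickP => // w /and3P[_ vw gw].
by have := fr _ vw; rewrite gw.
Qed.

Lemma partnerK : involutive partner.
Proof.
case=> v u; rewrite {2}/partner /=.
case: pickP => [w /and3P[vu vw /eqP gw]|none].
  by apply: partnerE => //; rewrite gw exchangeK.
by rewrite /partner; case: pickP => // w; rewrite none.
Qed.

Definition swap (O : pred (T * T)) : T -> T -> 'I_t * bool :=
  fun v u => if O (v, u) then exchange (g v u) else g v u.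

(** Slots are untouched by the exchange, so the condition on parents survives; two
darts at v could only clash if one is the partner of the other, and then both or
none of them are swapped. *)
Lemma swap_labelling (O : pred (T * T)) :
  (forall p, O p -> O (partner p)) -> (forall p, O p -> O (opposite p)) ->
  labelling e (swap O).
Proof.
move=> Opartner Oopp; have [gsym ginj gpar] := g_lab; rewrite /swap; split.
- move=> u v; have -> : O (v, u) = O (u, v) by apply/idP/idP => /Oopp.
  by case: ifP => _ //=; rewrite gsym.
- have mixed v u w : e v u -> e v w -> O (v, u) -> ~~ O (v, w) ->
      exchange (g v u) <> g v w.
    move=> vu vw Ou nOw E; have := Opartner _ Ou.
    by rewrite (partnerE vu vw (esym E)) (negPf nOw).
  move=> v u w vu vw; case: ifP => Ou; case: ifP => Ow.
  + by move/(inv_inj exchangeK); apply: ginj.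
  + by move/(mixed _ _ _ vu vw Ou (negbT Ow)).
  + by move/esym/(mixed _ _ _ vw vu Ow (negbT Ou)).
  + exact: ginj.
- by move=> v u vu ruv; case: ifP => _ /=; apply: gpar.
Qed.

(** The label (b, false) being unused at z, the chain from z starts with the edge zw, and
the exchange frees its label.  At x only the dart labelled (b, s) could become (c, s),
and it is off the chain.  The last clause serves when z is y': the edge xy' and the
colour that is to move from it to xy must not be affected. *)
Lemma kempe_swap x u s z w :
  b != c ->
  free e g x (c, s) -> e x u -> g x u = (b, s) ->
  free e g z (b, false) -> e z w -> g z w = (c, false) ->
  ~~ fconnect (partner \o opposite) (z, w) (x, u) ->
  exists g', [/\ labelling e g', free e g' x (c, s), free e g' z (c, false) &
    forall v v' a s', a != b -> a != c -> (g' v v' == (a, s')) = (g v v' == (a, s'))].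
Proof.
move=> bc fx xu gu fz zw gw far.
pose O := fconnect (partner \o opposite) (z, w).
have zw_fix : partner (z, w) = (z, w).
  by apply: partner_fix; rewrite gw /exchange tpermR.
exists (swap O); split.
- by apply: swap_labelling => p /(fconnect_reflection oppositeK partnerK zw_fix)[].
- have [_ ginj _] := g_lab.
  move=> v xv; rewrite /swap; case: ifP => [Ov|_]; last exact: fx.
  apply: contraNneq far => E; rewrite (ginj x u v) // gu.
  by rewrite -[g x v]exchangeK E /exchange tpermR.
- have [_ ginj _] := g_lab.
  move=> v zv; rewrite /swap; case: ifP => [Ov|nOv].
    apply: contraTneq (fz _ zv) => E; rewrite -[g z v]exchangeK E /exchange tpermR.
    by rewrite eqxx.
  apply: contraFneq nOv => E; rewrite (ginj z v w) // ?E //.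
  exact: connect0.
- move=> v v' a s' ab ac; rewrite /swap; case: ifP => // _.
  rewrite -[RHS](inj_eq (inv_inj exchangeK)) {3}/exchange /=.
  by rewrite tpermD // eq_sym.
Qed.

End Kempe.

(** * Existence of labellings *)

Lemma exists_notin (L : finType) (A : {set L}) : #|A| < #|L| -> exists l, l \notin A.
Proof.
move=> ltA; apply/existsP; rewrite -negb_forall; apply: contraTN ltA => /forallP inA.
by rewrite -leqNgt subset_leq_card //; apply/subsetP => l _.
Qed.

(** The induction step.  All edges at a child of x go to parents, so they use the slot
[false] there and there are at most k of them; this is what makes two children of x
see few enough colours to leave a common one unused. *)
Lemma extend_labelling k e g x y :
  0 < k -> 2 * k - 1 <= t -> symmetric e -> (forall u v, e u v -> r u != r v) ->
  (forall v, #|[set u | e v u & r u < r v]| <= k) ->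
  (forall v, #|[set u | e v u]| <= 2 * t) ->
  e x y -> r x < r y ->
  (forall z u, e x z -> r x < r z -> e z u -> r u < r z) ->
  labelling (del e x y) g -> exists g', labelling e g'.
Proof.
move=> k_gt0 le_kt esym rank parents degree xy rxy sinks; set d := del e x y => g_lab.
have dsub u v : d u v -> e u v by case/andP.
have dxyF : d x y = false by rewrite /d /del /is_pair !eqxx andbF.
have dyxF : d y x = false by rewrite /d /del /is_pair !eqxx orbT andbF.
have dsym : symmetric d.
  by move=> u v; rewrite /d /del esym /is_pair orbC (andbC (u == y)) (andbC (u == x)).
have [gsym ginj gpar] := g_lab.
have direct g' c s : labelling d g' -> free d g' x (c, s) ->
    free d g' y (c, false) -> exists g', labelling e g'.
  by move=> lab' fx fy; eexists; apply: relabel_labelling lab' fx fy.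
have [[c s] fx] : exists l, free d g x l.
  have [|l Al] := @exists_notin _ [set g x u | u in [set u | d x u]].
    apply: leq_ltn_trans (leq_imset_card _ _) _.
    rewrite card_prod card_ord card_bool mulnC.
    apply: leq_trans (degree x); apply/proper_card/properP; split.
      by apply/subsetP => u; rewrite !inE => /andP[].
    by exists y; rewrite !inE ?xy // dxyF.
  exists l => u xu; apply: contraNneq Al => <-.
  by apply/imsetP; exists u; rewrite ?inE.
pose colours v := [set (g v u).1 | u in [set u | d v u]].
have sink_slot z u : e x z -> r x < r z -> d z u -> (g z u).2 = false.
  by move=> xz rxz zu; apply: gpar => //; apply: (sinks z u) => //; apply: dsub.
have free_colour v a s' : a \notin colours v -> free d g v (a, s').
  move=> av u vu; apply: contraNneq av => E; apply/imsetP; exists u; rewrite ?inE //.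
  by rewrite E.
have colour_edge z a : e x z -> r x < r z -> a \in colours z ->
    exists2 w, d z w & g z w = (a, false).
  move=> xz rxz /imsetP[w]; rewrite inE => zw ->; exists w => //.
  by rewrite -(sink_slot z w) // -surjective_pairing.
have card_y : #|colours y| < k.
  apply: leq_ltn_trans (leq_imset_card _ _) _.
  apply: leq_trans (parents y); apply/proper_card/properP; split.
    apply/subsetP => u; rewrite !inE => /andP[yu _]; rewrite yu.
    exact: (sinks y u).
  by exists x; rewrite inE ?dyxF // esym xy.
have card_child z : e x z -> r x < r z -> #|colours z| <= k.
  move=> xz rxz; apply: leq_trans (leq_imset_card _ _) _.
  apply: leq_trans (parents z); apply/subset_leq_card/subsetP => u.
  by rewrite !inE => /andP[zu _]; rewrite zu (sinks z u).
have [cy|/free_colour cy] := boolP (c \in colours y); last exact: (direct g c s).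
have [|a ay] := @exists_notin _ (colours y); first by rewrite card_ord; lia.
have [y' /andP[xy' /eqP gy']|none] := pickP [pred u | d x u && (g x u == (a, true))]; last first.
  apply: (direct g a true g_lab _ (free_colour _ _ _ ay)) => u xu.
  have : d x u && (g x u == (a, true)) = false := none u.
  by rewrite xu => /negbT.
have exy' := dsub _ _ xy'.
(* A dart with slot true does not go to a parent. *)
have rxy' : r x < r y'.
  rewrite ltn_neqAle rank //= leqNgt; apply/negP => lt.
  by have := gpar _ _ xy' lt; rewrite gy'.
have yy' : y != y' by apply: contraTneq xy' => <-; rewrite dxyF.
have xNy : x != y by apply: contraTneq rxy => ->; rewrite ltnn.
have xNy' : x != y' by apply: contraTneq rxy' => ->; rewrite ltnn.
have ca : c != a by apply: contraNneq ay => <-.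
(* Give xy' the colour c, which frees (a, true) at x for the edge xy. *)
have rotate g' : labelling d g' -> free d g' x (c, s) -> free d g' y' (c, false) ->
    g' x y' = (a, true) -> free d g' y (a, false) -> exists g', labelling e g'.
  move=> lab' fx' fy' gxy' fya.
  have delsub u v : del d x y' u v -> d u v by case/andP.
  have lab1 : labelling d (relabel g' x y' (c, s) (c, false)).
    apply: relabel_labelling => // [|u /delsub|u /delsub]; first exact: labelling_sub lab'.
      exact: fx'.
    exact: fy'.
  apply: (direct _ a true lab1) => u du; rewrite /relabel.
    rewrite eqxx (negPf xNy') /=; have [_|uy'] := eqVneq u y'.
      by rewrite xpair_eqE (negPf ca).
    apply: contraNneq uy' => E; apply/eqP; have [_ ginj' _] := lab'.
    by apply: (ginj' x) => //; rewrite E.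
  by rewrite (eq_sym y x) (negPf xNy) (negPf yy') /=; apply: fya.
have [cy'|/free_colour cy'] := boolP (c \in colours y'); last first.
  by apply: (rotate g) => //; apply: free_colour.
have [w yw gyw] := colour_edge _ _ xy rxy cy.
have [w' yw' gyw'] := colour_edge _ _ exy' rxy' cy'.
have [|b] := @exists_notin _ (colours y :|: colours y').
  have arith U I A B : U + I = A + B -> 0 < I -> A < k -> B <= k -> U < t.
    by clear -le_kt; lia.
  rewrite card_ord; apply: arith (cardsUI _ _) _ card_y (card_child _ exy' rxy').
  by apply/card_gt0P; exists c; rewrite inE cy.
rewrite inE negb_or => /andP[by_ by'].
have bc : b != c by apply: contraNneq by_ => ->.
have ab : a != b.
  apply: contraNneq by' => <-; apply/imsetP; exists x; rewrite ?inE.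
    by rewrite dsym.
  by rewrite gsym gy'.
have [u /andP[xu /eqP gu]|none] := pickP [pred u | d x u && (g x u == (b, s))]; last first.
  apply: (direct g b s g_lab _ (free_colour _ _ _ by_)) => u xu.
  have : d x u && (g x u == (b, s)) = false := none u.
  by rewrite xu => /negbT.
have ac : a != c by rewrite eq_sym.
have fby := free_colour _ _ false by_; have fby' := free_colour _ _ false by'.
have [con|far] := boolP (fconnect (partner d g b c \o opposite) (y, w) (x, u)); last first.
  have [g' [lab' fx' fy' _]] := kempe_swap g_lab bc fx xu gu fby yw gyw far.
  exact: direct lab' fx' fy'.
(* The chain from y ends at x, so by the bound on ends that from y' does not. *)
have far : ~~ fconnect (partner d g b c \o opposite) (y', w') (x, u).
  have opK := @oppositeK; have paK := partnerK b c g_lab.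
  apply/negP; rewrite (fconnect_sym (step_inj opK paK)) => /(connect_trans con) con'.
  have fix_end v u' l : free d g v (exchange b c l) -> g v u' = l ->
      partner d g b c (v, u') = (v, u').
    by move=> fl gl; apply: partner_fix; rewrite gl.
  have E : (x, u) = (y', w').
    apply: (fixpoints_in_orbit opK paK _ _ _ _ _ con con').
    - by apply: (fix_end _ _ (c, false)) => //; rewrite /exchange tpermR.
    - by apply: (fix_end _ _ (b, s)) => //; rewrite /exchange tpermL.
    - by apply: (fix_end _ _ (c, false)) => //; rewrite /exchange tpermR.
    - by rewrite xpair_eqE (negPf xNy).
    - by rewrite xpair_eqE eq_sym (negPf yy').
  by case: E xNy' => ->; rewrite eqxx.
have [g' [lab' fx' fy' same]] := kempe_swap g_lab bc fx xu gu fby' yw' gyw' far.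
apply: (rotate g') => // [|v yv]; first by apply/eqP; rewrite same // gy'.
by rewrite same //; apply: free_colour.
Qed.

Lemma labelling_exists k e :
  0 < k -> 2 * k - 1 <= t -> symmetric e -> (forall u v, e u v -> r u != r v) ->
  (forall v, #|[set u | e v u & r u < r v]| <= k) ->
  (forall v, #|[set u | e v u]| <= 2 * t) ->
  exists g, labelling e g.
Proof.
move=> k_gt0 le_kt.
have [n] := ubnP #|[set p : T * T | e p.1 p.2]|.
elim: n e => // n IHn e lt_n esym rank parents degree.
pose has_child := [pred x | [exists y, e x y && (r x < r y)]].
have [x0 x0P|no_child] := pickP has_child; last first.
  have t_gt0 : 0 < t by lia.
  have e0 u v : e u v = false.
    apply/negP => uv; have := rank _ _ uv; rewrite neq_ltn => /orP[] lt.
      by have /existsP[] := no_child u; exists v; rewrite uv.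
    by have /existsP[] := no_child v; exists u; rewrite esym uv.
  exists (fun _ _ => (Ordinal t_gt0, false)).
  by split=> // v u w; rewrite e0.
case: (@arg_maxnP _ x0 has_child r x0P) => x /existsP[y /andP[xy rxy]] xmax.
have [g g_lab] : exists g, labelling (del e x y) g.
  apply: IHn => [|u v|u v|v|v].
  - rewrite -ltnS; apply: leq_ltn_trans lt_n; apply/proper_card/properP; split.
      by apply/subsetP => p; rewrite !inE => /andP[].
    by exists (x, y); rewrite !inE //= /del /is_pair !eqxx andbF.
  - by rewrite /del esym /is_pair orbC (andbC (u == y)) (andbC (u == x)).
  - by case/andP => + _; apply: rank.
  - apply: leq_trans (parents v); apply/subset_leq_card/subsetP => u.
    by rewrite !inE => /andP[/andP[-> _] ->].
  - apply: leq_trans (degree v); apply/subset_leq_card/subsetP => u.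
    by rewrite !inE => /andP[].
apply: (extend_labelling k_gt0 le_kt _ _ _ _ xy rxy _ g_lab) => // z u xz rxz zu.
rewrite ltn_neqAle rank 1?esym //= leqNgt; apply/negP => lt_zu.
have : r z <= r x by apply: xmax; apply/existsP; exists u; rewrite zu.
by rewrite leqNgt rxz.
Qed.

End Labellings.

(** * Ranks of degenerate graphs *)

(** The vertex removed first gets the highest rank, so the neighbours of lower rank
are those present when the vertex is removed. *)
Lemma reducible_rank (G : sgraph) k (S : {set G}) :
  reducible k S ->
  exists2 r : G -> nat,
    {in S &, forall u v, adj u v -> r u != r v} &
    {in S, forall v, #|[set u in S | adj v u & r u < r v]| <= k}.
Proof.
elim=> {S} [S S1|S x xS degx _ [r rank parents]].
  exists (fun _ => 0) => [u v uS vS uv|v _].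
    by move: uv; rewrite (card_le1_eqP S1 u v uS vS) adj_irrefl.
  by apply: leq_trans (leq0n k); rewrite leqn0 cards_eq0; apply/eqP/setP=> u; rewrite !inE !andbF.
pose r' u := if u == x then (\max_(w : G) r w).+1 else r u.
have top u : u != x -> r' u < r' x.
  by rewrite /r' eqxx => /negPf->; rewrite ltnS; apply: leq_bigmax.
exists r' => [u v uS vS uv|v vS].
  have [ux|ux] := eqVneq u x; have [vx|vx] := eqVneq v x.
  - by move: uv; rewrite ux vx adj_irrefl.
  - by rewrite ux neq_ltn top ?orbT.
  - by rewrite vx neq_ltn top.
  - by rewrite /r' (negPf ux) (negPf vx); apply: rank; rewrite // !inE ?ux ?vx.
have [->|vx] := eqVneq v x.
  apply: leq_trans degx; apply/subset_leq_card/subsetP => u.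
  by rewrite !inE => /and3P[-> -> _].
apply: leq_trans (parents v _); last by rewrite !inE vx.
apply/subset_leq_card/subsetP => u; rewrite !inE => /and3P[uS vu ruv].
have ux : u != x.
  by apply: contraTneq ruv => ->; rewrite -leqNgt ltnW // top.
by move: ruv; rewrite uS vu /r' (negPf ux) (negPf vx).
Qed.

(** * Paths and linear forests *)

Section Paths.

Variable T : finType.
Implicit Types (p q : seq T) (h : rel T).

Lemma set2_eq (a b c d : T) :
  [set a; b] = [set c; d] -> a = c /\ b = d \/ a = d /\ b = c.
Proof.
move=> E; have [] := (set21 a b, set22 a b); rewrite E !inE.
have [] := (set21 c d, set22 c d); rewrite -E !inE.
by do 4!(case/orP=> /eqP ?); subst; auto.
Qed.

Lemma path_edges1 (a : T) : path_edges [:: a] = set0.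
Proof. by apply/setP => E; rewrite inE; apply/imsetP => -[]. Qed.

Lemma path_edges_cons a b p :
  path_edges [:: a, b & p] = [set a; b] |: path_edges (b :: p).
Proof.
apply/setP => E; rewrite !inE; apply/imsetP/orP => [[u]|[/eqP->|/imsetP[u up ->]]].
- rewrite inE => /orP[/eqP-> ->|up ->]; first by left.
  by right; apply/imsetP; exists u.
- by exists (a, b); rewrite // inE eqxx.
- by exists u; rewrite // inE up orbT.
Qed.

Lemma path_edges_cat p a q :
  path_edges (p ++ a :: q) = path_edges (rcons p a) :|: path_edges (a :: q).
Proof.
elim: p => [|b p IHp] /=; first by rewrite path_edges1 set0U.
case: p IHp => [|c p] /= IHp; first by rewrite !path_edges_cons path_edges1 setU0.
by rewrite !path_edges_cons IHp setUA.
Qed.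

Lemma path_edgesP p E :
  E \in path_edges p -> exists p1 a b p2, p = p1 ++ [:: a, b & p2] /\ E = [set a; b].
Proof.
elim: p => [|a [|b p] IHp]; first by case/imsetP.
  by rewrite path_edges1 inE.
rewrite path_edges_cons => /setU1P[->|/IHp[p1 [c [d [p2 [-> ->]]]]]].
  by exists [::], a, b, p.
by exists (a :: p1), c, d, p2.
Qed.

Definition edge_set h (A : {pred T}) : {set {set T}} :=
  [set [set u; v] | u in A, v in A & h u v].

Lemma edge_setE h A u v : symmetric h ->
  ([set u; v] \in edge_set h A) = [&& u \in A, v \in A & h u v].
Proof.
move=> hsym; apply/imset2P/and3P => [[u' v' u'A]|[uA vA uv]]; last first.
  by exists u v => //; rewrite inE vA.
rewrite inE => /andP[v'A uv'] /set2_eq[] [-> ->] //.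
by rewrite hsym.
Qed.

Lemma edge_setP h A E :
  E \in edge_set h A -> exists u v, [/\ u \in A, v \in A, h u v & E = [set u; v]].
Proof.
by case/imset2P=> u v uA; rewrite inE => /andP[vA uv] ->; exists u, v.
Qed.

(** A graph of maximum degree 2 in which, for some order, every vertex has at most one
neighbour after it, is a disjoint union of paths.  Reading the order backwards, each
vertex v either starts a path or is attached to its unique earlier neighbour u.
Having degree at most 2 including v, u is an end of its path. *)
Lemma path_forest h s :
  symmetric h -> irreflexive h -> uniq s ->
  (forall v, #|[set u | h v u]| <= 2) ->
  (forall s1 v s2, s = s1 ++ v :: s2 -> {in s2 &, forall u w, h v u -> h v w -> u = w}) ->
  exists ps : seq (seq T),
    [/\ [::] \notin ps, perm_eq (flatten ps) s
      & edge_set h (mem s) = \bigcup_(p <- ps) path_edges p].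
Proof.
move=> hsym hirr + deg2.
elim: s => [_ _|v s IHs /= /andP[vs us] parent].
  exists [::]; split=> //; rewrite big_nil; apply/setP => E; rewrite inE.
  by apply/imset2P => -[].
have [|ps [ps0 ps_s psE]] := IHs us.
  by move=> s1 w s2 sE; apply: (parent (v :: s1)); rewrite sE.
have edge_cons E : E \in edge_set h (mem (v :: s)) =
    (E \in edge_set h (mem s)) || [exists u in s, h v u && (E == [set v; u])].
  apply/idP/orP => [|[]].
  - case/imset2P => a b; rewrite !inE => /orP[/eqP->|aS] /andP[/orP[/eqP->|bS] ab] ->.
    + by rewrite hirr in ab.
    + by right; apply/existsP; exists b; rewrite bS ab eqxx.
    + by right; apply/existsP; exists a; rewrite aS hsym ab setUC eqxx.
    + by left; rewrite edge_setE // aS bS.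
  - case/imset2P => a b aS; rewrite inE => /andP[bS ab] ->.
    by rewrite edge_setE // !inE ab (aS : a \in s) (bS : b \in s) !orbT.
  - case/existsP => u /and3P[uS vu /eqP->].
    by rewrite edge_setE // !inE eqxx uS vu orbT.
have [u /andP[uS vu]|none] := pickP [pred u | (u \in s) && h v u]; last first.
  exists ([:: v] :: ps); split.
  - by rewrite inE.
  - by rewrite /= perm_cons.
  - rewrite big_cons path_edges1 set0U -psE; apply/setP => E.
    rewrite edge_cons orbC; case: existsP => // -[u /and3P[uS vu _]].
    by have := none u; rewrite /= uS vu.
have {}edge_cons : edge_set h (mem (v :: s)) = [set v; u] |: edge_set h (mem s).
  apply/setP => E; rewrite edge_cons !inE orbC; congr (_ || _).
  apply/existsP/eqP => [[w /and3P[wS vw /eqP->]]|->]; last first.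
    by exists u; rewrite uS vu eqxx.
  by rewrite (parent [::] v s erefl u w).
have /flattenP[p pps up] : u \in flatten ps by rewrite (perm_mem ps_s).
have [ps' perm_ps] : exists ps', perm_eq ps (p :: ps').
  by exists (rem p ps); apply: perm_to_rem.
have flat : perm_eq (p ++ flatten ps') s.
  by move: ps_s; rewrite (permPl (perm_flatten perm_ps)).
have psE' : edge_set h (mem s) = path_edges p :|: \bigcup_(q <- ps') path_edges q.
  by rewrite psE (perm_big _ perm_ps) big_cons.
(* The path p through u is extended by v into q; the other paths stay. *)
suff [q [q0 qp qE]] : exists q, [/\ q != [::], perm_eq q (v :: p)
    & path_edges q = [set v; u] |: path_edges p].
  exists (q :: ps'); split.
  - rewrite inE negb_or eq_sym q0 /=; apply: contra ps0 => e0.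
    by rewrite (perm_mem perm_ps) inE e0 orbT.
  - by rewrite /= (perm_trans (y := (v :: p) ++ flatten ps')) ?perm_cat2r //= perm_cons.
  - by rewrite edge_cons psE' big_cons qE setUA.
have : uniq p /\ v \notin p.
  have := perm_uniq flat; rewrite us cat_uniq => /andP[-> _]; split=> //.
  by apply: contra vs => vp; rewrite -(perm_mem flat) mem_cat vp.
have hp a b : [set a; b] \in path_edges p -> h a b.
  by move=> ab; have : [set a; b] \in edge_set h (mem s);
     [rewrite psE' inE ab | rewrite edge_setE // => /and3P[]].
case/splitPr: p / up hp {pps perm_ps flat psE'} => p1 p2 hp [up vp].
case: (lastP p1) hp up vp => [|p1' a] hp up vp.
  by exists [:: v, u & p2]; split=> //; rewrite path_edges_cons.
case: p2 hp up vp => [|b p2] hp up vp.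
  exists (rcons p1' a ++ [:: u; v]); split.
  - by case: (p1').
  - by rewrite -[[:: u; v]]/([:: u] ++ [:: v]) catA cats1 perm_rcons.
  - by rewrite path_edges_cat path_edges_cons path_edges1 setU0 cats1 [RHS]setUC (setUC [set v]).
have au : h a u.
  apply: hp; rewrite cat_rcons path_edges_cat path_edges_cons !inE eqxx.
  by rewrite orbT.
have ub : h u b by apply: hp; rewrite path_edges_cat path_edges_cons !inE eqxx orbT.
have /subset_leq_card : [set a; b; v] \subset [set w | h u w].
  by apply/subsetP => w; rewrite !inE => /orP[/orP[]|] /eqP->; rewrite // hsym.
move=> /leq_trans/(_ (deg2 u)).
have va : v != a by apply: contraNneq vp => ->; rewrite !(mem_cat, mem_rcons, inE) eqxx.
have vb : v != b by apply: contraNneq vp => ->; rewrite !(mem_cat, mem_rcons, inE) eqxx !orbT.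
have ab : a != b.
  apply: contraTneq up => ->.
  by rewrite cat_uniq; apply/negP => /and3P[_ /hasPn/(_ b)]; rewrite !(mem_rcons, inE) eqxx orbT => /(_ isT).
by rewrite setUC !cardsU1 !inE cards1 negb_or va vb ab.
Qed.

End Paths.

Lemma mem_flatten_inj (T : eqType) (ps : seq (seq T)) p q x :
  uniq (flatten ps) -> p \in ps -> q \in ps -> x \in p -> x \in q -> p = q.
Proof.
move=> ups pps; rewrite (perm_mem (perm_to_rem pps)) inE => /orP[/eqP->//|qps] xp xq.
move: ups; rewrite (perm_uniq (perm_flatten (perm_to_rem pps))) /= cat_uniq.
case/and3P=> _ /hasPn/(_ x) + _; rewrite xp => /(_ _)/negP[] //.
by apply/flattenP; exists q.
Qed.

Lemma mem_bigcup_seq (I : eqType) (T : finType) (s : seq I) (F : I -> {set T}) y :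
  y \in \bigcup_(i <- s) F i -> exists2 i, i \in s & y \in F i.
Proof.
elim: s => [|i s IHs]; first by rewrite big_nil inE.
rewrite big_cons => /setUP[yi|/IHs[j js yj]]; first by exists i; rewrite ?mem_head.
by exists j; rewrite // inE js orbT.
Qed.

Lemma linear_forest_degree (T : finType) (F : {set {set T}}) x :
  linear_forest F -> #|[set y | [set x; y] \in F]| <= 2.
Proof.
move=> [ps [_ ps_enum ->]].
have uflat : uniq (flatten ps) by rewrite (perm_uniq ps_enum) enum_uniq.
have /flattenP[p pps xp] : x \in flatten ps by rewrite (perm_mem ps_enum) mem_enum.
have up : uniq p.
  have := perm_uniq (perm_flatten (perm_to_rem pps)).
  by rewrite uflat cat_uniq => /esym/andP[].
have [p1 [p2 pE]] : exists p1 p2, p = p1 ++ x :: p2.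
  by case/splitPr: xp => p1 p2; exists p1, p2.
suff sub : [set y | [set x; y] \in \bigcup_(q <- ps) path_edges q]
    \subset [set last x p1; head x p2].
  by apply: leq_trans (subset_leq_card sub) _; rewrite cards2; case: eqP.
have split_p q1 q2 : p = q1 ++ x :: q2 -> q1 = p1 /\ q2 = p2.
  by move/eqP; rewrite pE uniq_eqseq_pivotl -?pE // => /andP[/eqP-> /eqP->].
apply/subsetP => y; rewrite !inE => /mem_bigcup_seq[q qps].
case/path_edgesP=> q1 [a [b [q2 [qE /set2_eq xyE]]]].
have pq : p = q.
  apply: (mem_flatten_inj uflat pps qps xp); rewrite qE mem_cat !inE.
  by case: xyE => -[-> _]; rewrite eqxx !orbT.
rewrite -pq in qE; case: xyE => -[? ?]; subst a b.
  by have [_ <-] := split_p _ _ qE; rewrite eqxx orbT.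
by rewrite -cat_rcons in qE; have [<- _] := split_p _ _ qE; rewrite last_rcons eqxx.
Qed.

Lemma max_degree_le_linear_forests (G : sgraph) n :
  linear_forest_partition G n -> max_degree G <= n.*2.
Proof.
move=> [P [/and3P[/eqP coverP _ _] forestP <-]].
apply/bigmax_leqP => x _.
pose N (F : {set {set G}}) := [set y | [set x; y] \in F].
have sub : [set y in [set: G] | adj x y] \subset \bigcup_(F in P) N F.
  apply/subsetP => y; rewrite !inE => xy.
  have : [set x; y] \in cover P by rewrite coverP; apply/imset2P; exists x y; rewrite ?inE.
  by case/bigcupP => F FP xyF; apply/bigcupP; exists F; rewrite ?inE.
apply: leq_trans (subset_leq_card sub) _.
rewrite -muln2 -sum_nat_const.
elim/big_rec2: _ => [|F m A FP le_Am]; first by rewrite cards0.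
apply: leq_trans (leq_card_setU _ _) _.
by apply: leq_add => //; apply: linear_forest_degree; apply: forestP.
Qed.

(** * Linear arboricity of degenerate graphs *)

(** A colour class has at most two edges at each vertex, one for each slot, and at most
one edge to a parent, with slot [false]; listing the vertices by decreasing rank makes
it a disjoint union of paths.  Colours that are not used have to be dropped, since a
partition has no empty block. *)
Lemma linear_forests_of_labelling (G : sgraph) (r : G -> nat) t
    (g : G -> G -> 'I_t * bool) :
  (forall u v : G, adj u v -> r u != r v) -> labelling r (@adj G) g ->
  exists2 n, n <= t & linear_forest_partition G n.
Proof.
move=> rank [gsym ginj gpar].
pose h c : rel G := fun u v => adj u v && ((g u v).1 == c).
pose F c := edge_set (h c) (mem G).
have hsym c : symmetric (h c) by move=> u v; rewrite /h adj_sym gsym.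
have inF c u v : ([set u; v] \in F c) = h c u v by rewrite edge_setE.
exists #|[set F c | c : 'I_t] :\ set0|.
  apply: leq_trans (subset_leq_card (subD1set _ _)) _.
  by apply: leq_trans (leq_imset_card _ _) _; rewrite card_ord.
exists ([set F c | c : 'I_t] :\ set0); split=> //.
- apply/and3P; split; last by rewrite !inE eqxx.
  + apply/eqP/setP => E; apply/bigcupP/imset2P => [[X /setD1P[_ /imsetP[c _ ->]]]|].
      by case/edge_setP=> u [v [_ _ /andP[uv _] ->]]; exists u v; rewrite ?inE.
    move=> [u v _ /[!inE] /= uv ->].
    have uvF : [set u; v] \in F (g u v).1 by rewrite inF /h uv eqxx.
    exists (F (g u v).1) => //; rewrite !inE imset_f // andbT.
    by apply: contraTneq uvF => ->; rewrite inE.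
  + apply/trivIsetP => _ _ /setD1P[_ /imsetP[c _ ->]] /setD1P[_ /imsetP[c' _ ->]] neq.
    rewrite -setI_eq0; apply: contraNT neq => /set0Pn[E /setIP[]].
    case/edge_setP=> u [v [_ _ /andP[uv /eqP<-] ->]].
    by rewrite inF => /andP[_ /eqP->].
- move=> _ /setD1P[_ /imsetP[c _ ->]].
  pose s := sort (fun u v => r v <= r u) (enum G).
  have [||v|s1 v s2 sE u w us ws|ps [ps0 ps_s psE]] := @path_forest _ (h c) s (hsym c).
  + by move=> u; rewrite /h adj_irrefl.
  + by rewrite sort_uniq enum_uniq.
  + have /subset_leq_card : [set g v u | u in [set u | h c v u]]
        \subset [set (c, true); (c, false)].
      apply/subsetP => l /imsetP[u]; rewrite inE => /andP[_ /eqP <-] ->.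
      by rewrite !inE [g v u]surjective_pairing /=; case: (g v u).2; rewrite eqxx ?orbT.
    rewrite card_in_imset => [|u w]; last first.
      by rewrite !inE => /andP[vu _] /andP[vw _]; apply: ginj.
    by move/leq_trans; apply; rewrite cards2; case: eqP.
  + have : sorted (fun u v => r v <= r u) s by apply: sort_sorted => a b; apply: leq_total.
    rewrite sE sorted_cat_cons => /andP[_].
    move/(order_path_min (fun a b d ba db => leq_trans db ba))/allP => le_v.
    have parent z : z \in s2 -> h c v z -> g v z = (c, false).
      move=> zs /andP[vz /eqP gvz]; rewrite [g v z]surjective_pairing gpar //.
        by rewrite gsym -gvz gsym.
      by rewrite ltn_neqAle le_v // andbT eq_sym rank.
    move=> vu vw; apply: (ginj v); rewrite ?parent //.
      by case/andP: vu.
    by case/andP: vw.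
  + exists ps; split=> //; first by rewrite (perm_trans ps_s) // perm_sort.
    rewrite -psE; apply/setP => E.
    by apply/imset2P/imset2P => -[u v uG vG ->]; exists u v;
      rewrite ?inE ?mem_sort ?mem_enum // in uG vG *.
Qed.

Lemma linear_arboricity_degenerate (k : nat) (G : sgraph) :
  0 < k -> degenerate k G -> 4 * k - 3 <= max_degree G ->
  linear_arboricity G = uphalf (max_degree G).
Proof.
move=> k_gt0 /reducible_rank[r rank parents] le_k.
have {}rank u v : adj u v -> r u != r v by apply: rank; rewrite inE.
set t := uphalf (max_degree G).
have [|||v|v|g g_lab] := @labelling_exists G r t k (@adj G) k_gt0.
- by rewrite /t; lia.
- exact: adj_sym.
- exact: rank.
- apply: leq_trans (parents v _); rewrite ?inE //.
  by apply/subset_leq_card/subsetP => u; rewrite !inE.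
- apply: leq_trans (_ : max_degree G <= _); last by rewrite /t; lia.
  have -> : [set u | adj v u] = [set u in [set: G] | adj v u] by apply/setP=> u; rewrite !inE.
  exact: (leq_bigmax (F := degree_in [set: G])).
have [n le_nt partn] := linear_forests_of_labelling rank g_lab.
rewrite /linear_arboricity; case: ex_minnP => m /asboolP partm minm.
apply/eqP; rewrite eqn_leq (leq_trans (minm _ (introT (asboolP _) partn))) //=.
by rewrite leq_uphalf_double max_degree_le_linear_forests.
Qed.

(* [uphalf n] is the ceiling of n / 2 *)
Theorem theorem1p3 (k : nat) (G : sgraph) :
  0 < k -> degenerate k G -> 2 * k ^ 2 - k <= max_degree G ->
  linear_arboricity G = uphalf (max_degree G).
Proof.
move=> k_gt0 dG le_k; apply: linear_arboricity_degenerate dG _ => //.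
(* (2k^2 - k) - (4k - 3) = (2k - 3)(k - 1) *)
by apply: leq_trans le_k; nia.
Qed.
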